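(* Suppose that $(u,\mu)$ is a global conservative multipeakon solution of the Camassa-Holm equation and let $\{\lambda_i\}_{i=1}^N$ be the eigenvalues of the associated spectral problem $-f''+\frac14f=z\,\omega(\cdot,t)f+z^2v(\cdot,t)f$ on $\mathbb{R}$. For a fixed $t\in\mathbb{R}$, let $\{\varphi_i(x,t)\}_{i=1}^N$ be the corresponding normalized eigenfunctions. Then for every $x\in\mathbb{R}$ $$u(x,t)=\frac12\sum_{i=1}^N\frac{|\varphi_i(x,t)|^2}{\lambda_i}.$$
   Context: Camassa-Holm equation: $u_t-u_{xxt}=2u_xu_{xx}-3uu_x+uu_{xxx}$. Spectral problem: for $\omega=\sum_{i=1}^n\omega_i\delta_{x_i}$, $v=\sum_{i=1}^nv_i\delta_{x_i}$ with $n\ge1$, $x_1<\dots<x_n$ real, $\omega_i\in\mathbb{R}$, $v_i\ge0$, $|\omega_i|+v_i>0$, a solution of $-f''+\frac14f=z\omega f+z^2vf$ ($z\in\mathbb{C}$) is a continuous $f$ with $-f''+\frac14f=0$ on $\mathbb{R}\setminus\{x_1,\dots,x_n\}$ and $f'(x_i-)=f'(x_i+)+z\omega_if(x_i)+z^2v_if(x_i)$ for every $i$. Eigenvalues are the $z$ for which there is a nontrivial bounded solution; they form a finite set of nonzero reals $\lambda_1<\dots<\lambda_N$. $\phi_+(z,\cdot)$ is the solution equal to $e^{-x/2}$ near $+\infty$; for an eigenvalue $\lambda$, $\gamma_\lambda^2:=\int_{\mathbb{R}}|\phi_+(\lambda,x)|^2d\omega(x)+2\lambda\int_{\mathbb{R}}|\phi_+(\lambda,x)|^2dv(x)$,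 with $\lambda\gamma_\lambda^2>0$; the normalized eigenfunctions are $\varphi_i(x)=\phi_+(\lambda_i,x)/\sqrt{\lambda_i\gamma_{\lambda_i}^2}$. Global conservative multipeakon solution $(u,\mu)$: for each $t\in\mathbb{R}$, $u(\cdot,t)=\frac12\sum_{i=1}^{n(t)}\omega_i(t)e^{-|x-x_i(t)|}$, so that $\omega(\cdot,t):=u-u_{xx}=\sum_{i=1}^{n(t)}\omega_i(t)\delta_{x_i(t)}$; $\mu(\cdot,t)$ is a nonnegative Borel measure with absolutely continuous part $\mu_{ac}(B,t)=\int_B|u(x,t)|^2+|u_x(x,t)|^2dx$, and $v(B,t):=\mu(B,t)-\int_B|u(x,t)|^2+|u_x(x,t)|^2dx$ is $\sum_{i=1}^{n(t)}v_i(t)\delta_{x_i(t)}$ with $v_i(t)\ge0$, $|\omega_i(t)|+v_i(t)>0$. The pair $(u,\mu)$ being a global conservative multipeakon solution is characterized (Eckhardt-Kostenko; this may be taken as the definition) by: the eigenvalues of the spectral problem with coefficients $\omega(\cdot,t),v(\cdot,t)$ do not depend on $t$, and $\gamma_{\lambda_i}^2(t)=e^{-\frac{t-t_0}{2\lambda_i}}\gamma_{\lambda_i}^2(t_0)$ for all $t,t_0\in\mathbb{R}$ and all eigenvalues $\lambda_i$. Here $\gamma^2_{\lambda_i}(t)$ and $\varphi_i(x,t)$ are the quantities above for the coefficients $\omega(\cdot,t),v(\cdot,t)$. *)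

(* Defs.v *)
From HB Require Import structures.
From mathcomp Require Import all_boot all_order all_algebra.
From mathcomp Require Import complex.
From mathcomp Require Import all_classical all_reals all_analysis.

Set Implicit Arguments.
Unset Strict Implicit.
Unset Printing Implicit Defensive.

Import Order.TTheory GRing.Theory Num.Theory.
Import numFieldNormedType.Exports.

Local Open Scope classical_set_scope.
Local Open Scope complex_scope.
Local Open Scope ring_scope.

(* R[i] carries no topology or normed R-module structure in the libraries, so
   limits and derivatives of functions R -> R[i] are taken componentwise. *)
Section ComplexValued.
Context {R : realType}.
Implicit Types (f : R -> R[i]) (x : R) (l z : R[i]).

Definition ccvg f (F : set_system R) l : Prop :=
  ((fun y => complex.Re (f y)) @ F --> complex.Re l) /\
  ((fun y => complex.Im (f y)) @ F --> complex.Im l).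

Definition ccontinuous f : Prop := forall x, ccvg f (nbhs x) (f x).

Definition cderivable f x : Prop :=
  derivable (fun y => complex.Re (f y)) x 1 /\
  derivable (fun y => complex.Im (f y)) x 1.

Definition cderive f x : R[i] :=
  derive1 (fun y => complex.Re (f y)) x +i*
  derive1 (fun y => complex.Im (f y)) x.

(* The norm of R[i] takes its (real) values in R[i]. *)
Definition cabs z : R := complex.Re `|z|.

End ComplexValued.

(* The pair omega = \sum_i strength i * delta_(pos i),
   v = \sum_i energy i * delta_(pos i). *)
Record coefficients (R : realType) := Coefficients {
  npeaks : nat;
  pos : 'I_npeaks -> R;
  strength : 'I_npeaks -> R;
  energy : 'I_npeaks -> R;
  npeaks_gt0 : (0 < npeaks)%N;
  pos_increasing : forall i j : 'I_npeaks, (i < j)%N -> pos i < pos j;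
  energy_ge0 : forall i, 0 <= energy i;
  nondegenerate : forall i, 0 < `|strength i| + energy i
}.
Arguments npeaks {R} c : rename.
Arguments pos {R} c i : rename.
Arguments strength {R} c i : rename.
Arguments energy {R} c i : rename.

Section SpectralProblem.
Context {R : realType}.
Implicit Types (c : coefficients R) (z : R[i]) (f : R -> R[i]) (l : R).

(* - f'' + f / 4 = z omega f + z^2 v f *)
Definition is_solution c z f : Prop :=
  [/\ ccontinuous f,
      forall x, (forall i, x <> pos c i) ->
        [/\ cderivable f x, cderivable (cderive f) x &
            - cderive (cderive f) x + 4^-1 * f x = 0]
    & forall i, exists dl dr : R[i],
        [/\ ccvg (cderive f) (at_left (pos c i)) dl,
            ccvg (cderive f) (at_right (pos c i)) dr &
            dl = dr + z * (strength c i)%:C * f (pos c i)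
                 + z ^+ 2 * (energy c i)%:C * f (pos c i)]].

Definition is_eigenvalue c z : Prop :=
  exists f, [/\ is_solution c z f,
                exists x, f x <> 0
              & exists M : R, forall x, cabs (f x) <= M].

Definition is_phi_plus c z f : Prop :=
  is_solution c z f /\ \forall x \near +oo, f x = (expR (- (x / 2)))%:C.

(* The function satisfying is_phi_plus c z; it exists and is unique for every z,
   so the default value of xget is never used. *)
Definition phi_plus c z : R -> R[i] :=
  xget (fun=> 0 : R[i]) [set f | is_phi_plus c z f].

(* gamma_l^2; omega and v being finite combinations of point masses, the
   integrals against them are finite sums. *)
Definition gamma2 c l : R :=
  \sum_(i < npeaks c) strength c i * cabs (phi_plus c l%:C (pos c i)) ^+ 2
  + 2 * l * \sum_(i < npeaks c) energy c i * cabs (phi_plus c l%:C (pos c i)) ^+ 2.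

Definition normalized_eigenfunction c l (x : R) : R[i] :=
  phi_plus c l%:C x / (Num.sqrt (l * gamma2 c l))%:C.

(* l enumerates the eigenvalues, i.e. all complex z admitting a nontrivial
   bounded solution, in increasing order. *)
Definition is_spectrum c (N : nat) (l : 'I_N -> R) : Prop :=
  (forall i j : 'I_N, (i < j)%N -> l i < l j) /\
  (forall z, is_eigenvalue c z <-> exists i, z = (l i)%:C).

End SpectralProblem.

(* u is a function of (x, t) and mu t a measure on the Borel sets of R; c t
   consists of omega(., t) and v(., t).  The derivative of u(., t) exists outside
   the finitely many peaks, so that the values of u_x there do not affect the
   integral.  As v(., t) is singular, the integral is the absolutely continuous
   part of mu t. *)
Record global_conservative_multipeakon (R : realType) (u : R -> R -> R)
    (mu : R -> {measure set (measurableTypeR R) -> \bar R})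
    (c : R -> coefficients R) : Prop := {
  multipeakon_profile : forall t x,
    u x t = 2^-1 * \sum_(i < npeaks (c t))
                     strength (c t) i * expR (- `|x - pos (c t) i|);
  multipeakon_energy : forall t (B : set (measurableTypeR R)), measurable B ->
    (mu t B - \int[@lebesgue_measure R]_(x in B)
                (`|u x t| ^+ 2 + `|derive1 (fun y => u y t) x| ^+ 2)%:E
     = \sum_(i < npeaks (c t)) (energy (c t) i)%:E * \d_(pos (c t) i) B)%E;
  multipeakon_isospectral : forall t t0 z,
    is_eigenvalue (c t) z <-> is_eigenvalue (c t0) z;
  multipeakon_evolution : forall t t0 l, is_eigenvalue (c t0) l%:C ->
    gamma2 (c t) l = expR (- ((t - t0) / (2 * l))) * gamma2 (c t0) l
}.

(* Main.v *)
Require Import Defs.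
From mathcomp Require Import all_boot all_order all_algebra.
From mathcomp Require Import complex.
From mathcomp Require Import all_classical all_reals all_analysis.
From mathcomp Require Import ring lra.

Set Implicit Arguments.
Unset Strict Implicit.
Unset Printing Implicit Defensive.

Import Order.TTheory GRing.Theory Num.Theory.
Import numFieldNormedType.Exports.

Local Open Scope classical_set_scope.
Local Open Scope ring_scope.

(** Write omega_k for the strengths, v_k for the energies and x_k for the
positions of the peaks at the given time.  By the form of the profile of u, the
claim is the trace formula

  sum_k omega_k exp (- |x - x_k|) = sum_i |phi_i (x)|^2 / lambda_i

for the spectral problem, where phi_i are the normalized eigenfunctions.

The Green function of - f'' + f / 4 is G (x, a) = exp (- |x - a| / 2), so f is a
bounded solution at the real parameter z exactly when

  f (x) = sum_k (z omega_k + z^2 v_k) f (x_k) G (x, x_k).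

Hence the values y of an eigenfunction at the peaks form a row vector with
y = y (z Omega + z^2 V) E, where E = (G (x_j, x_k)), Omega = diag (omega_k) and
V = diag (v_k), and every nonzero solution of this problem is obtained so.  With
g = z sqrt V y the pencil becomes linear: psi = (y, g) satisfies
psi B K = psi / z, with B the symmetric block matrix with rows (Omega, sqrt V)
and (sqrt V, 0), and K = diag (E, 1).  As E = L L^T with an explicit triangular
L (kernel_factor), K = M M^T and S = M^T B M is a symmetric matrix with
eigenvalues 1 / z.  Expanding S in its eigenvectors and evaluating the quadratic
form at the vector h with h M^T = ((G (x, x_k))_k, 0) gives
sum_k omega_k G (x, x_k)^2, that is the left-hand side, and the square of the
component of h along the i-th eigenvector is |phi_i (x)|^2, because
psi_i B (G (x, .), 0)^T = phi_+ (lambda_i, x) / lambda_i and the squared norm of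
the eigenvector is lambda_i gamma_i^2 (pencil_trace).

The expansion of S over the known eigenvectors is obtained by deflation
(symmetric_expansion): subtracting their contribution leaves a symmetric matrix
which, if nonzero, would have a real eigenvector for a nonzero eigenvalue
orthogonal to all of them; but every nonzero eigenvalue of S is some
1 / lambda_i and has a one-dimensional eigenspace.

On the analytic side everything follows from one normal form
(jump_solution_hump, hump_jump_solution): a solution with jumps d_k of the
derivative is a e^(x/2) + b e^(-x/2) + sum_k d_k hump_k (x), where hump_k is
supported to the left of x_k.  For d_k = m_k f (x_k) the values f (x_k) are then
determined from right to left by the behaviour near +oo, which gives uniqueness
of phi_+ and simplicity of the eigenvalues. *)

(** * Spectral expansion of real symmetric matrices *)

Section LinAlg.
Variable R : rcfType.

(** The matrix is unitarily diagonalizable over R[i] with real eigenvalues; they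
cannot all vanish, and the real or the imaginary part of an eigenvector for a
nonzero one is a real eigenvector. *)
Lemma symmetric_eigenvector n (T : 'M[R]_n) : T^T = T -> T != 0 ->
  exists (a : R) (v : 'rV[R]_n), [/\ a != 0, v != 0 & v *m T = a *: v].
Proof.
move=> symT T0.
pose C : 'M[R[i]]_n := map_mx (real_complex R) T.
have Creal : C \is a mxOver Num.real.
  by apply/mxOverP => i j; rewrite mxE; apply/complex_realP; exists (T i j).
have Csym : C \is symmetricmx.
  by apply/is_hermitianmxP; rewrite expr0 scale1r map_mx_id // /C map_trmx symT.
have herm := realsym_hermsym Csym Creal.
have /mxOverP Dreal := hermitian_spectral_diag_real herm.
have := orthomx_spectralP (hermitian_normalmx herm).
set P := spectralmx C; set D := spectral_diag C => CE.
have Punit : P \in unitmx := spectral_unit C.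
have [j Dj] : exists j, D 0 j != 0.
  apply/existsP; apply: contraNT T0; rewrite negb_exists => /forallP D0.
  have {}D0 : D = 0.
    by apply/rowP => j; rewrite mxE; apply/eqP; have := D0 j; rewrite negbK.
  have C0 : C = 0.
    by rewrite CE D0 (_ : diag_mx 0 = 0) ?mulmx0 ?mul0mx // raddf0.
  apply/eqP/matrixP => a b; have /matrixP/(_ a b) := C0.
  by rewrite !mxE => /complexI.
have /complex_realP [d dE] := Dreal 0 j.
have rowE : row j P *m C = d%:C%C *: row j P.
  rewrite CE !mulmxA -row_mul mulmxV // row1 -dE.
  by rewrite -rowE row_diag_mx -scalemxAl -rowE.
have row0 : row j P != 0.
  apply: contraTneq Punit => r0; rewrite -row_free_unit.
  apply/negP => /row_freeP [Q PQ].
  have /rowP/(_ j) : row j P *m Q = row j 1%:M by rewrite -row_mul PQ.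
  by rewrite r0 mul0mx !mxE eqxx => /esym/eqP; rewrite oner_eq0.
have d0 : d != 0 by apply: contraNneq Dj => d0; rewrite dE d0.
pose re : 'rV[R]_n := map_mx (@complex.Re R) (row j P).
pose im : 'rV[R]_n := map_mx (@complex.Im R) (row j P).
have reE : re *m T = d *: re.
  apply/rowP => k; have /rowP/(_ k) := rowE; rewrite !mxE.
  move/(congr1 (@complex.Re R)); rewrite raddf_sum /=.
  under eq_bigr => i _ do rewrite !mxE.
  case: (P j k) => a b /=; rewrite mul0r subr0 => <-.
  apply: eq_bigr => i _; rewrite !mxE /=; case: (P j i) => x y /=.
  by rewrite mulr0 subr0.
have imE : im *m T = d *: im.
  apply/rowP => k; have /rowP/(_ k) := rowE; rewrite !mxE.
  move/(congr1 (@complex.Im R)); rewrite raddf_sum /=.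
  under eq_bigr => i _ do rewrite !mxE.
  case: (P j k) => a b /=; rewrite mul0r addr0 => <-.
  apply: eq_bigr => i _; rewrite !mxE /=; case: (P j i) => x y /=.
  by rewrite mulr0 add0r.
have [re0|re0] := eqVneq re 0; last by exists d, re.
exists d, im; split => //; apply: contraNneq row0 => im0.
apply/eqP/rowP => k; have /rowP/(_ k) := re0; have /rowP/(_ k) := im0.
by rewrite !mxE; case: (P j k) => a b /= -> ->.
Qed.

Definition dotr n (u v : 'rV[R]_n) : R := (u *m v^T) 0 0.

Lemma dotrE n (u v : 'rV[R]_n) : u *m v^T = (dotr u v)%:M.
Proof. exact: mx11_scalar. Qed.

Lemma dotrC n (u v : 'rV[R]_n) : dotr u v = dotr v u.
Proof. by rewrite /dotr !mxE; apply: eq_bigr => i _; rewrite !mxE mulrC. Qed.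

Lemma dotrZl n a (u v : 'rV[R]_n) : dotr (a *: u) v = a * dotr u v.
Proof. by rewrite /dotr -scalemxAl mxE. Qed.

Lemma dotr_suml n N (u : 'I_N -> 'rV[R]_n) (v : 'rV[R]_n) :
  dotr (\sum_i u i) v = \sum_i dotr (u i) v.
Proof. by rewrite /dotr mulmx_suml summxE. Qed.

Lemma dotr_gt0 n (u : 'rV[R]_n) : u != 0 -> 0 < dotr u u.
Proof.
move=> u0; rewrite /dotr mxE.
have ge0 (i : 'I_n) : true -> 0 <= u 0 i * u^T i 0.
  by move=> _; rewrite mxE -expr2 sqr_ge0.
rewrite lt_def sumr_ge0 // andbT; apply: contraNneq u0 => s0.
apply/eqP/rowP => i; have z := psumr_eq0P ge0 s0; move: (z i isT).
by rewrite !mxE -expr2 => /eqP; rewrite sqrf_eq0 => /eqP.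
Qed.

Lemma symmetric_eigen_orthogonal n (S : 'M[R]_n) a b (u v : 'rV[R]_n) :
  S^T = S -> u *m S = a *: u -> v *m S = b *: v -> a != b -> dotr u v = 0.
Proof.
move=> symS uS vS ab.
have : dotr (u *m S) v = dotr (v *m S) u.
  by rewrite [RHS]dotrC /dotr trmx_mul symS mulmxA.
rewrite uS vS !dotrZl (dotrC v) => /eqP; rewrite -subr_eq0 -mulrBl mulf_eq0.
by rewrite subr_eq0 (negPf ab) => /eqP.
Qed.

(** The completeness hypothesis says at once that every nonzero eigenvalue is
listed and that its eigenspace is a line.  The difference T of the two sides
annihilates every e i, so an eigenvector of T for a nonzero eigenvalue is
orthogonal to all the e i; it is also an eigenvector of S, hence a multiple of
some e i, hence zero. *)
Lemma symmetric_expansion n (S : 'M[R]_n) N (a : 'I_N -> R)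
    (e : 'I_N -> 'rV[R]_n) :
  S^T = S -> injective a -> (forall i, e i != 0) ->
  (forall i, e i *m S = a i *: e i) ->
  (forall b w, b != 0 -> w != 0 -> w *m S = b *: w ->
     exists i k, w = k *: e i) ->
  S = \sum_i (a i / dotr (e i) (e i)) *: ((e i)^T *m e i).
Proof.
move=> symS inja e0 eS complete; apply/eqP; rewrite -subr_eq0.
set T := S - _; apply: contraT => T0.
have symT : T^T = T.
  rewrite linearB /= symS linear_sum /=; congr (_ - _); apply: eq_bigr => i _.
  by rewrite linearZ /= trmx_mul trmxK.
have eT i : e i *m T = 0.
  rewrite mulmxBr eS mulmx_sumr (bigD1 i) //= big1 => [|j ji].
    rewrite addr0 -scalemxAr mulmxA dotrE mul_scalar_mx scalerA divfK ?subrr //.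
    by rewrite gt_eqF // dotr_gt0.
  rewrite -scalemxAr mulmxA dotrE.
  rewrite (symmetric_eigen_orthogonal symS (eS i) (eS j)).
    by rewrite mul_scalar_mx scale0r scaler0.
  by rewrite (inj_eq inja) eq_sym.
have [b [w [b0 w0 wT]]] := symmetric_eigenvector symT T0.
have we i : dotr w (e i) = 0.
  apply: (symmetric_eigen_orthogonal symT wT (b := 0)) => //.
  by rewrite eT scale0r.
have wS : w *m S = b *: w.
  rewrite -wT mulmxBr mulmx_sumr big1 ?subr0 // => i _.
  by rewrite -scalemxAr mulmxA dotrE we mul_scalar_mx scale0r scaler0.
have [i [k wE]] := complete b w b0 w0 wS.
by have := dotr_gt0 w0; rewrite {2}wE dotrC dotrZl dotrC we mulr0 ltxx.
Qed.

(** * Trace formula for a quadratic matrix pencil *)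

Section Pencil.
Variables (n : nat) (L : 'M[R]_n) (om v : 'rV[R]_n).
Hypothesis v_ge0 : forall k, 0 <= v 0 k.
Hypothesis L_unit : L \in unitmx.

Definition weight l : 'M[R]_n := diag_mx (l *: om + l ^+ 2 *: v).

Let sq : 'M[R]_n := diag_mx (map_mx Num.sqrt v).
Let B : 'M[R]_(n + n) := block_mx (diag_mx om) sq sq 0.
Let M : 'M[R]_(n + n) := block_mx L 0 0 1%:M.
Let psi l (y : 'rV[R]_n) : 'rV[R]_(n + n) := row_mx y (l *: (y *m sq)).

Let sqsq : sq *m sq = diag_mx v.
Proof.
rewrite /sq mulmx_diag; congr diag_mx; apply/rowP => k.
by rewrite !mxE -expr2 sqr_sqrtr.
Qed.

Let weightE l : weight l = l *: (diag_mx om + l *: diag_mx v).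
Proof. by rewrite /weight raddfD /= !linearZ /= scalerDr scalerA -expr2. Qed.

Let psiB l y : psi l y *m B = row_mx (y *m (diag_mx om + l *: diag_mx v)) (y *m sq).
Proof.
rewrite /psi /B mul_row_block mulmx0 addr0 -scalemxAl -mulmxA sqsq.
by rewrite mulmxDr -scalemxAr.
Qed.

Let MMT : M *m M^T = block_mx (L *m L^T) 0 0 1%:M.
Proof.
rewrite /M tr_block_mx !trmx0 trmx1 mulmx_block.
by rewrite !(mulmx0, mul0mx, addr0, add0r, mulmx1).
Qed.

(** The linearization: psi l y is the vector (y, l y sqrt V), for which the
quadratic pencil at l becomes the generalized linear eigenvalue problem
psi B (M M^T) = psi / l. *)
Let psiBK l y : l != 0 -> y *m weight l *m (L *m L^T) = y ->
  psi l y *m B *m (M *m M^T) = l^-1 *: psi l y.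
Proof.
move=> l0 yE; rewrite psiB MMT mul_row_block !mulmx0 addr0 add0r mulmx1.
rewrite /psi scale_row_mx scalerA mulVf // scale1r; congr row_mx.
by rewrite -[in RHS]yE weightE -scalemxAr -scalemxAl scalerA mulVf ?scale1r.
Qed.

Let trB : B^T = B.
Proof. by rewrite /B tr_block_mx !tr_diag_mx trmx0. Qed.

(** Apply symmetric_expansion to S = M^T B M, whose eigenvectors are
e = l psi B M with e M^T = psi.  Its quadratic form at h = (q, 0) M^(-T) is
q Omega q^T, while the components are e h^T = y (l Omega + l^2 V) q^T and
e e^T = l psi B psi^T = l (y Omega y^T + 2 l y V y^T). *)
Lemma pencil_trace N (l : 'I_N -> R) (y : 'I_N -> 'rV[R]_n) (q : 'rV[R]_n) :
  injective l -> (forall i, l i != 0) -> (forall i, y i != 0) ->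
  (forall i, y i *m weight (l i) *m (L *m L^T) = y i) ->
  (forall b w, b != 0 -> w != 0 -> w *m weight b *m (L *m L^T) = w ->
     exists i k, b = l i /\ w = k *: y i) ->
  let gam i := dotr (y i *m diag_mx om) (y i)
               + 2 * l i * dotr (y i *m diag_mx v) (y i) in
  (forall i, 0 < l i * gam i) /\
  dotr (q *m diag_mx om) q =
    \sum_i dotr (y i *m weight (l i)) q ^+ 2 / (l i * gam i) / l i.
Proof.
move=> injl l0 y0 yE complete gam.
pose e i := l i *: (psi (l i) (y i) *m B *m M).
have eMT i : e i *m M^T = psi (l i) (y i).
  rewrite /e -scalemxAl -mulmxA psiBK // scalerA mulfV // scale1r //.
pose S := M^T *m B *m M.
have symS : S^T = S by rewrite /S !trmx_mul trmxK trB mulmxA.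
have e0 i : e i != 0.
  apply: contraNneq (y0 i) => ei0; have := eMT i.
  by rewrite ei0 mul0mx -(row_mx0 _ 1 n n) => /eq_row_mx[<- _].
have eS i : e i *m S = (l i)^-1 *: e i.
  by rewrite /S !mulmxA eMT /e scalerA mulVf // scale1r.
have ee i : dotr (e i) (e i) = l i * gam i.
  rewrite {1}/e dotrZl; congr (_ * _).
  rewrite /dotr -mulmxA -[M *m _]trmxK trmx_mul trmxK eMT psiB /psi.
  rewrite tr_row_mx mul_row_col mxE /gam mulmxDr mulmxDl mxE -addrA.
  congr (_ + _); rewrite -scalemxAr -scalemxAl linearZ /= -scalemxAr trmx_mul.
  by rewrite tr_diag_mx !mulmxA -[y i *m sq *m sq]mulmxA sqsq [in LHS]mxE /dotr; ring.
have MT_unit : M^T \in unitmx.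
  by rewrite unitmx_tr unitmxE det_ublock det1 mulr1 -unitmxE.
have Sexp := @symmetric_expansion _ S N (fun i => (l i)^-1) e symS.
split=> [i|]; first by rewrite -ee dotr_gt0.
pose h := row_mx q 0 *m invmx M^T.
have hMT : h *m M^T = row_mx q 0 by rewrite /h mulmxKV.
have hSh : dotr (h *m S) h = dotr (q *m diag_mx om) q.
  rewrite /dotr /S !mulmxA hMT -mulmxA -[M *m _]trmxK trmx_mul trmxK hMT.
  rewrite /B mul_row_block !mul0mx !addr0 tr_row_mx mul_row_col trmx0.
  by rewrite mulmx0 addr0.
have eh i : dotr (e i) h = dotr (y i *m weight (l i)) q.
  rewrite /e dotrZl /dotr -mulmxA -[M *m _]trmxK trmx_mul trmxK hMT psiB.
  rewrite tr_row_mx mul_row_col trmx0 mulmx0 addr0 weightE -scalemxAr.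
  by rewrite -[in RHS]scalemxAl [in RHS]mxE.
rewrite -hSh Sexp => [||//|//|b w b0 w0 wS]; last 2 first.
- by move=> i j /invr_inj/injl.
- pose z := lsubmx (w *m M^T); pose g := rsubmx (w *m M^T).
  have wzg : w *m M^T = row_mx z g by rewrite hsubmxK.
  have wS' : w *m M^T *m B *m (M *m M^T) = b *: (w *m M^T).
    by rewrite scalemxAl -wS /S !mulmxA.
  move: wS'; rewrite wzg MMT /B !mul_row_block !mulmx0 !addr0 add0r mulmx1.
  rewrite scale_row_mx => /eq_row_mx[zE gE].
  have gz : g = b^-1 *: (z *m sq) by rewrite gE scalerA mulVf ?scale1r.
  have wpsi : w *m M^T = psi b^-1 z by rewrite wzg /psi gz.
  have z0 : z != 0.
    apply: contraNneq w0 => z0; move: wpsi.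
    rewrite z0 /psi mul0mx scaler0 row_mx0 => wM.
    by rewrite -(mulmxK MT_unit w) wM mul0mx.
  have zW : z *m weight b^-1 *m (L *m L^T) = z.
    rewrite weightE -scalemxAr -scalemxAl; move: zE.
    rewrite gz -scalemxAl -mulmxA sqsq scalemxAr -mulmxDr => ->.
    by rewrite scalerA mulVf ?scale1r.
  have [i [k [bE zk]]] := complete _ _ (invr_neq0 b0) z0 zW.
  exists i, k; rewrite /e.
  have -> : w = b^-1 *: (w *m S) by rewrite wS scalerA mulVf ?scale1r.
  rewrite /S !mulmxA wpsi bE zk scalerA mulrC -scalerA; congr (_ *: _).
  by rewrite /psi -scalemxAl scalerA mulrC -scalerA -scale_row_mx -!scalemxAl.
have dotr_proj (c : R) (w : 'rV[R]_(n + n)) :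
    dotr (h *m (c *: (w^T *m w))) h = c * dotr w h ^+ 2.
  rewrite -scalemxAr dotrZl mulmxA (dotrE h) mul_scalar_mx dotrZl.
  by rewrite dotrC expr2.
rewrite mulmx_sumr dotr_suml; apply: eq_bigr => i _.
rewrite dotr_proj eh ee; field.
have := dotr_gt0 (e0 i); rewrite ee l0 /=.
by apply: contraTneq => ->; rewrite mulr0 ltxx.
Qed.
End Pencil.
End LinAlg.

(** * Factorization of the exponential kernel *)

Section Kernel.
Variables (R : realType) (n : nat) (x : 'I_n -> R).
Hypothesis x_lt : forall i j : 'I_n, (i < j)%N -> x i < x j.

(** For x_j <= x_k the kernel is exp (- x_j / 2) exp (- x_k / 2) exp (x_j), that
is a rank-one rescaling of the Brownian covariance min (s_j, s_k) with
s = exp x.  The latter is the Gram matrix of sums of independent increments,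
which yields a triangular factor with positive diagonal. *)
Lemma kernel_factor : exists2 L : 'M[R]_n, L \in unitmx &
  L *m L^T = \matrix_(j, k) expR (- (`|x j - x k| / 2)).
Proof.
(* s is shifted by one so that s 0 = 0 and the first increment is exp (x 0). *)
pose s m := if m is k.+1 then oapp (fun i => expR (x i)) 0 (insub k) else 0.
have sS (i : 'I_n) : s i.+1 = expR (x i) by rewrite /s /= valK.
pose d m := s m.+1 - s m.
have d_gt0 (i : 'I_n) : 0 < d i.
  rewrite /d sS subr_gt0; case: i => -[|m] mn; first by rewrite expR_gt0.
  by rewrite (sS (Ordinal (ltnW mn))) ltr_expR; apply: x_lt.
pose L := \matrix_(j < n, m < n)
  if (m <= j)%N then expR (- (x j / 2)) * Num.sqrt (d m) else 0.
exists L.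
  rewrite unitmxE det_trig; last first.
    by apply/is_trig_mxP => i j ij; rewrite mxE leqNgt ij.
  rewrite unitfE; apply/prodf_neq0 => i _; rewrite mxE leqnn mulf_neq0 //.
    by rewrite gt_eqF // expR_gt0.
  by rewrite gt_eqF // sqrtr_gt0.
have LL (j k : 'I_n) : (j <= k)%N ->
    (L *m L^T) j k = expR (- (x j / 2)) * expR (- (x k / 2)) * expR (x j).
  move=> jk; rewrite mxE -sS -[s _]subr0 -[X in _ - X]/(s 0).
  rewrite -(telescope_sumr _ (leq0n _)) big_mkord mulr_sumr.
  rewrite (big_ord_widen n (fun m => _ * _ * d m)) // [RHS]big_mkcond.
  apply: eq_bigr => m _; rewrite !mxE ltnS.
  case: ifP => mj; last by rewrite mul0r.
  rewrite (leq_trans mj jk) mulrACA -expr2 sqr_sqrtr // ltW //.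
apply/matrixP => j k; rewrite [RHS]mxE.
wlog jk : j k / (j <= k)%N => [hw|].
  have [/hw//|/ltnW/hw h] := leqP j k.
  rewrite distrC -h -[in LHS](trmxK (L *m L^T)) [in LHS]mxE.
  by rewrite trmx_mul trmxK.
rewrite LL // -!expRD; congr expR.
have xjk : x j <= x k.
  by move: jk; rewrite leq_eqVlt => /orP[/eqP/val_inj->//|/x_lt/ltW].
rewrite ler0_norm ?subr_le0 //; lra.
Qed.
End Kernel.

(** * Homogeneous solutions of - f'' + f / 4 = 0 *)

Section Free.
Variable R : realType.
Implicit Types (A B x a : R) (g : R -> R) (D : set R).

Definition homsol A B x : R := A * expR (x / 2) + B * expR (- (x / 2)).

Lemma is_derive_homsol A B x :
  is_derive x 1 (homsol A B) (homsol (A / 2) (- B / 2) x).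
Proof.
pose k : R := 2^-1.
have lin c : is_derive x (1 : R) (fun y : R => c * y) c.
  have -> : (fun y : R => c * y) = c \*: id by [].
  by apply: is_derive_eq; rewrite /GRing.scale /= mulr1.
have e1 c : is_derive x 1 (expR \o (fun y : R => c * y)) (expR (c * x) * c).
  exact: is_derive1_comp.
have -> : homsol A B =
    A \*: (expR \o (fun y : R => k * y)) + B \*: (expR \o (fun y : R => - k * y)).
  by apply/funext => y; rewrite /homsol !fctE /GRing.scale /= mulNr (mulrC y).
apply: is_derive_eq; rewrite /homsol /GRing.scale /= mulNr (mulrC x) /k; ring.
Qed.

Lemma derive1_homsol A B : derive1 (homsol A B) = homsol (A / 2) (- B / 2).
Proof.
by apply/funext => x; rewrite derive1E; have [] := is_derive_homsol A B x.
Qed.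

Lemma derivable_homsol A B x : derivable (homsol A B) x 1.
Proof. by have [] := is_derive_homsol A B x. Qed.

Lemma continuous_homsol A B : continuous (homsol A B).
Proof.
by move=> x; apply: differentiable_continuous; apply/derivable1_diffP;
  apply: derivable_homsol.
Qed.

Lemma derive_eq0_constant D g : is_interval D ->
  (forall x, D x -> is_derive x 1 g 0) -> forall x y, D x -> D y -> g x = g y.
Proof.
move=> itvD g0 x y; wlog xy : x y / x <= y => [hw Dx Dy|Dx Dy].
  by have [/hw->//|/ltW/hw->] := leP x y.
have sub z : z \in `[x, y] -> D z by rewrite in_itv /=; apply: itvD.
have [||c _] := @MVT_segment _ g (fun=> 0) x y xy.
- by move=> z /subset_itv_oo_cc zxy; apply/g0/sub.
- apply: derivable_within_continuous => z /sub/g0[dg _]; exact: dg.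
by rewrite /= mul0r => /eqP; rewrite subr_eq0 => /eqP.
Qed.

(** The quantities exp (- c x) (g' + c g) with c = 1/2 and c = - 1/2 are
conserved along the equation, and g is recovered from their two values. *)
Lemma homsol_of_ode D g : is_interval D -> D !=set0 ->
  (forall x, D x -> [/\ derivable g x 1, derivable (derive1 g) x 1 &
     derive1 (derive1 g) x = 4^-1 * g x]) ->
  exists A B, forall x, D x -> g x = homsol A B x.
Proof.
move=> itvD [x0 Dx0] ode.
have conserved c : c ^+ 2 = 4^-1 -> forall x, D x ->
    is_derive x 1 (fun y => expR (- c * y) * (derive1 g y + c * g y)) 0.
  move=> c2 x /ode[dg ddg eq_g].
  have lin : is_derive x (1 : R) (fun y : R => - c * y) (- c).
    have -> : (fun y : R => - c * y) = (- c) \*: id by [].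
    by apply: is_derive_eq; rewrite /GRing.scale /= mulr1.
  have dE : is_derive x 1 (expR \o (fun y => - c * y)) (expR (- c * x) * - c).
    exact: is_derive1_comp.
  have g1 : is_derive x 1 g (derive1 g x).
    by refine (DeriveDef dg _); rewrite derive1E.
  have g2 : is_derive x 1 (derive1 g) (4^-1 * g x).
    refine (DeriveDef ddg _); rewrite -derive1E.
    exact: eq_g.
  have -> : (fun y => expR (- c * y) * (derive1 g y + c * g y)) =
      (expR \o (fun y => - c * y)) * (derive1 g + c \*: g) by apply/funext.
  have /is_derive_eq := is_deriveM dE (is_deriveD g2 (is_deriveZ c g1)).
  apply; rewrite -c2 !fctE /GRing.scale /=.
  move: (g x) (derive1 g x) (expR _) => u w z.
  rewrite (_ : c *: u = c * u) //; ring.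
have c1 : (2^-1 : R) ^+ 2 = 4^-1 by field.
have c2 : (- 2^-1 : R) ^+ 2 = 4^-1 by rewrite sqrrN.
pose P y := expR (- 2^-1 * y) * (derive1 g y + 2^-1 * g y).
pose Q y := expR (- - 2^-1 * y) * (derive1 g y + - 2^-1 * g y).
exists (P x0), (- Q x0) => x Dx.
have PE : P x0 = P x := derive_eq0_constant itvD (conserved _ c1) Dx0 Dx.
have QE : Q x0 = Q x := derive_eq0_constant itvD (conserved _ c2) Dx0 Dx.
rewrite /homsol PE QE /P /Q opprK mulNr (mulrC 2^-1 x).
have ee : expR (x / 2) * expR (- (x / 2)) = 1 by rewrite -expRD subrr expR0.
transitivity (expR (x / 2) * expR (- (x / 2)) * g x); first by rewrite ee mul1r.
by field.
Qed.
End Free.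

(** * Local form of a solution at a peak *)

Section Local.
Variable R : realType.
Implicit Types (A B J a b e x : R) (g h : R -> R).

Lemma near_derive1 g h x : (\forall y \near x, g y = h y) ->
  \forall y \near x, derive1 g y = derive1 h y.
Proof.
move=> /near_join gh; near=> y; rewrite !derive1E; apply: near_eq_derive.
by near: y.
Unshelve. all: by end_near. Qed.

Lemma right_limit_homsol e a g A B l : 0 < e ->
  (forall x, a < x < a + e -> g x = homsol A B x) ->
  g x @[x --> a^'+] --> l -> l = homsol A B a.
Proof.
move=> e0 gE gl.
have gf : homsol A B x @[x --> a^'+] --> l.
  apply: cvg_trans gl; apply: near_eq_cvg; near=> x.
  rewrite gE //; apply/andP; split; near: x; first exact: nbhs_right_gt.
  by apply: nbhs_right_lt; rewrite ltrDl.
have ff : homsol A B x @[x --> a^'+] --> homsol A B a.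
  exact/cvg_at_right_filter/continuous_homsol.
exact: (cvg_unique _ gf ff).
Unshelve. all: by end_near. Qed.

Lemma left_limit_homsol e a g A B l : 0 < e ->
  (forall x, a - e < x < a -> g x = homsol A B x) ->
  g x @[x --> a^'-] --> l -> l = homsol A B a.
Proof.
move=> e0 gE gl.
have gf : homsol A B x @[x --> a^'-] --> l.
  apply: cvg_trans gl; apply: near_eq_cvg; near=> x.
  rewrite gE //; apply/andP; split; near: x; last exact: nbhs_left_lt.
  by apply: nbhs_left_gt; rewrite gtrBl.
have ff : homsol A B x @[x --> a^'-] --> homsol A B a.
  exact/cvg_at_left_filter/continuous_homsol.
exact: (cvg_unique _ gf ff).
Unshelve. all: by end_near. Qed.

Lemma near_in_oo a b x (P : R -> Prop) : a < x < b ->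
  (forall y, a < y < b -> P y) -> \forall y \near x, P y.
Proof.
move=> xab aP; have := @near_in_itvoo R a b x; rewrite in_itv /= => /(_ xab).
by apply: filterS => y; rewrite in_itv /=; exact: aP.
Qed.

(** The solution that vanishes to the right of a and whose derivative drops by
one across a, from left to right. *)
Definition hump a x : R :=
  if x < a then expR ((x - a) / 2) - expR ((a - x) / 2) else 0.

Lemma hump_left a x : x <= a ->
  hump a x = homsol (expR (- (a / 2))) (- expR (a / 2)) x.
Proof.
rewrite /hump /homsol le_eqVlt => /predU1P[->|->].
  by rewrite ltxx mulNr mulrC subrr.
by rewrite mulNr -!expRD; congr (expR _ - expR _); ring.
Qed.

Lemma hump_right a x : a <= x -> hump a x = 0.
Proof. by rewrite /hump ltNge => ->. Qed.

Lemma continuous_hump a : continuous (hump a).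
Proof.
have -> : hump a = homsol (expR (- (a / 2))) (- expR (a / 2)) \min cst 0.
  apply/funext => x /=; have [xa|xa] := leP x a.
    rewrite -hump_left // /hump; case: ifP => [_|]; last by rewrite minxx.
    by rewrite min_l // subr_le0 ler_expR; lra.
  rewrite hump_right ?ltW // min_r // /homsol mulNr -!expRD subr_ge0 ler_expR.
  by lra.
move=> x; apply: continuous_min; first exact: continuous_homsol.
exact: cst_continuous.
Qed.

Lemma homsol_add A B A' B' x :
  homsol A B x + homsol A' B' x = homsol (A + A') (B + B') x.
Proof. by rewrite /homsol; ring. Qed.

Lemma homsol_scale c A B x : c * homsol A B x = homsol (c * A) (c * B) x.
Proof. by rewrite /homsol; ring. Qed.

(** On each side of a the solution is homogeneous.  Continuity at a and the
jump dl - dr of the derivative are two linear equations which determine the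
coefficients on the left from those on the right; the difference is
(dl - dr) times the left branch of hump a.  A point where the equation holds is
the case dl = dr. *)
Lemma local_form_of_jump e a g dl dr : 0 < e -> {for a, continuous g} ->
  (forall x, a - e < x < a + e -> x != a ->
     [/\ derivable g x 1, derivable (derive1 g) x 1 &
       derive1 (derive1 g) x = 4^-1 * g x]) ->
  derive1 g x @[x --> a^'-] --> dl -> derive1 g x @[x --> a^'+] --> dr ->
  exists A B, \forall x \near a, g x = homsol A B x + (dl - dr) * hump a x.
Proof.
move=> e0 ga ode gl gr.
have itvoo (u v : R) : is_interval [set x | u < x < v].
  move=> x y /= /andP[ux _] /andP[_ yv] z /andP[xz zy].
  by rewrite (lt_le_trans ux xz) (le_lt_trans zy yv).
have half : 0 < e / 2 < e by lra.
have [||A [B gR]] := homsol_of_ode (itvoo a (a + e)) (g := g).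
- by exists (a + e / 2) => /=; lra.
- by move=> x /= xa; apply: ode; lra.
have [||A' [B' gL]] := homsol_of_ode (itvoo (a - e) a) (g := g).
- by exists (a - e / 2) => /=; lra.
- by move=> x /= xa; apply: ode; lra.
have gaR : g a = homsol A B a.
  by apply: (right_limit_homsol e0 gR); exact: cvg_at_right_filter.
have gaL : g a = homsol A' B' a.
  by apply: (left_limit_homsol e0 gL); exact: cvg_at_left_filter.
have drE : dr = homsol (A / 2) (- B / 2) a.
  apply: (right_limit_homsol e0 _ gr) => x xa; rewrite -derive1_homsol !derive1E.
  by apply: near_eq_derive; apply: near_in_oo xa gR.
have dlE : dl = homsol (A' / 2) (- B' / 2) a.
  apply: (left_limit_homsol e0 _ gl) => x xa; rewrite -derive1_homsol !derive1E.
  by apply: near_eq_derive; apply: near_in_oo xa gL.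
have ee : expR (a / 2) * expR (- (a / 2)) = 1 by rewrite -expRD subrr expR0.
have [A'E B'E] : A' = A + (dl - dr) * expR (- (a / 2)) /\
    B' = B - (dl - dr) * expR (a / 2).
  move: gaR gaL drE dlE; rewrite /homsol.
  move: (expR (a / 2)) (expR (- (a / 2))) ee => p q pq -> gaL -> ->.
  split.
    have -> : A' / 2 * p + - B' / 2 * q - (A / 2 * p + - B / 2 * q) =
      (A' - A) * p by lra.
    by rewrite -mulrA pq; ring.
  have -> : A' / 2 * p + - B' / 2 * q - (A / 2 * p + - B / 2 * q) =
    - ((B' - B) * q) by lra.
  by rewrite mulNr -mulrA (mulrC q) pq; ring.
exists A, B; apply: (@near_in_oo (a - e) (a + e)); first by lra.
move=> x /andP[xl xr]; have [xa|xa|->] := ltgtP x a.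
- rewrite gL /= ?xl ?xa // hump_left; last exact: ltW.
  rewrite homsol_scale homsol_add A'E B'E.
  by rewrite mulrN.
- rewrite gR /= ?xr ?xa // hump_right; last exact: ltW.
  by rewrite mulr0 addr0.
- by rewrite hump_right // mulr0 addr0.
Qed.
End Local.

(** * Global normal form of solutions with prescribed jumps *)

Section Global.
Variable R : realType.
Implicit Types (A B J a b e x : R) (g h : R -> R).

Lemma near_all a (P : R -> Prop) : (forall x, P x) -> \forall x \near a, P x.
Proof. by move=> Pall; near=> x. Unshelve. all: by end_near. Qed.

Definition locally_homsol a g :=
  exists A B, \forall x \near a, g x = homsol A B x.

Lemma locally_homsolD a g h : locally_homsol a g -> locally_homsol a h ->
  locally_homsol a (fun x => g x + h x).
Proof.
move=> [A [B gE]] [A' [B' hE]]; exists (A + A'), (B + B').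
by apply: filterS2 gE hE => x -> ->; rewrite homsol_add.
Qed.

Lemma locally_homsolZ a c g : locally_homsol a g -> locally_homsol a (fun x => c * g x).
Proof.
move=> [A [B gE]]; exists (c * A), (c * B).
by apply: filterS gE => x ->; rewrite homsol_scale.
Qed.

Lemma sum_closed (Q : (R -> R) -> Prop) n (P : pred 'I_n) (f : 'I_n -> R -> R) :
  Q (fun=> 0) -> (forall g h, Q g -> Q h -> Q (fun x => g x + h x)) ->
  (forall i, P i -> Q (f i)) -> Q (fun x => \sum_(i | P i) f i x).
Proof.
move=> Q0 QD Qf.
have -> : (fun x => \sum_(i | P i) f i x) =
    \big[(fun g h x => g x + h x)/(fun=> 0)]_(i | P i) f i.
  apply/funext => x.
  by elim/big_ind2: _ => // g u h v -> ->.
exact: big_ind.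
Qed.

Lemma locally_homsol_sum a n (P : pred 'I_n) (f : 'I_n -> R -> R) :
  (forall i, P i -> locally_homsol a (f i)) ->
  locally_homsol a (fun x => \sum_(i | P i) f i x).
Proof.
apply: sum_closed; last by move=> g h; apply: locally_homsolD.
by exists 0, 0; apply: near_all => x; rewrite /homsol !mul0r addr0.
Qed.

Lemma locally_homsol_hump a b : a != b -> locally_homsol a (hump b).
Proof.
rewrite neq_lt => /orP[ab|ba].
  exists (expR (- (b / 2))), (- expR (b / 2)).
  have := lt_nbhsl ab; apply: filterS => x /ltW; apply: hump_left.
exists 0, 0; have := lt_nbhsr ba; apply: filterS => x /ltW bx.
by rewrite hump_right // /homsol !mul0r addr0.
Qed.

Lemma locally_homsol_ode g x A B : (\forall y \near x, g y = homsol A B y) ->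
  [/\ derivable g x 1, derivable (derive1 g) x 1 &
    derive1 (derive1 g) x = 4^-1 * g x].
Proof.
move=> gE.
have g1 := near_derive1 gE; have g2 := near_derive1 g1.
have eg : \forall y \near x, homsol A B y = g y by apply: filterS gE.
have eg1 : \forall y \near x, homsol (A / 2) (- B / 2) y = derive1 g y.
  by apply: filterS g1 => y; rewrite derive1_homsol.
split.
- apply: (near_eq_derivable eg); exact: derivable_homsol.
- apply: (near_eq_derivable eg1); exact: derivable_homsol.
rewrite (nbhs_singleton g2) (nbhs_singleton gE) !derive1_homsol homsol_scale.
by congr homsol; field.
Qed.

(** Locally homogeneous functions satisfy the differential equation on the whole
line, so the coefficients cannot depend on the point. *)
Lemma homsol_of_locally_homsol g : (forall a, locally_homsol a g) ->
  exists A B, forall x, g x = homsol A B x.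
Proof.
move=> gE.
have [||x _|A [B gAB]] := @homsol_of_ode R setT g.
- by [].
- by exists 0.
- by have [A [B]] := gE x; exact: locally_homsol_ode.
by exists A, B => x; apply: gAB.
Qed.

Section JumpSolution.
Variables (n : nat) (X d : 'I_n -> R).

Definition jump_solution g := [/\ continuous g,
  forall x, (forall i, x <> X i) ->
    [/\ derivable g x 1, derivable (derive1 g) x 1 &
      derive1 (derive1 g) x = 4^-1 * g x] &
  forall i, exists dl dr, [/\ derive1 g x @[x --> (X i)^'-] --> dl,
    derive1 g x @[x --> (X i)^'+] --> dr & dl = dr + d i]].

Hypothesis X_inj : injective X.

Lemma isolated_peaks a :
  exists2 e, 0 < e & forall x, a - e < x < a + e -> x != a -> forall i, x <> X i.
Proof.
have : \forall x \near a, forall i, x != a -> x <> X i.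
  apply: (@filter_forall R _ (fun i x => x != a -> x <> X i) (nbhs a)) => i.
  have [->|aX] := eqVneq a (X i).
    by apply: near_all => x /eqP.
  move: aX; rewrite neq_lt => /orP[aX|Xa].
    by have := lt_nbhsl aX; apply: filterS => x xX _ xE; rewrite xE ltxx in xX.
  by have := lt_nbhsr Xa; apply: filterS => x xX _ xE; rewrite xE ltxx in xX.
move=> /nbhs_ballP[e /= e0 eP]; exists e => // x xa xna i.
by apply: eP => //; rewrite /ball /= ltr_distlC.
Qed.

(** Subtracting the humps removes all the jumps: the difference is locally
homogeneous at every point, hence homogeneous. *)
Lemma jump_solution_hump g : jump_solution g ->
  exists A B, forall x, g x = homsol A B x + \sum_i d i * hump (X i) x.
Proof.
move=> [cg ode jump].
have [a|A [B gE]] := @homsol_of_locally_homsol (fun x => g x - \sum_i d i * hump (X i) x).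
  have [e e0 eX] := isolated_peaks a.
  have ode_a x : a - e < x < a + e -> x != a ->
     [/\ derivable g x 1, derivable (derive1 g) x 1 &
       derive1 (derive1 g) x = 4^-1 * g x].
    by move=> xa xna; apply: ode; apply: eX.
  have hump_homsol (i : 'I_n) : X i != a ->
      locally_homsol a (fun x => - d i * hump (X i) x).
    by move=> Xa; apply/locally_homsolZ/locally_homsol_hump; rewrite eq_sym.
  (* At a peak only its own hump fails to be locally homogeneous. *)
  have [[i0 Xi0]|noX] := pselect (exists i, a = X i).
    have [dl [dr [gl gr dlr]]] := jump i0; rewrite -Xi0 in gl gr.
    have [A [B gE]] := local_form_of_jump e0 (cg a) ode_a gl gr.
    have lf : locally_homsol a (fun x => homsol A B x +
        \sum_(i | i != i0) - d i * hump (X i) x).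
      apply: locally_homsolD; first by exists A, B; apply: near_all.
      apply: locally_homsol_sum => i ii0; apply: hump_homsol.
      by rewrite Xi0 (inj_eq X_inj).
    have [A' [B' lfE]] := lf; exists A', B'.
    apply: filterS2 gE lfE => x -> <-.
    rewrite (bigD1 i0) //= dlr -Xi0 opprD addrA (addrC dr) addrK addrK.
    by rewrite -sumrN; congr (_ + _); apply: eq_bigr => i _; rewrite mulNr.
  have notX i : a <> X i by move=> aX; apply: noX; exists i.
  have [_ dg _] := ode _ notX.
  have cdg : {for a, continuous (derive1 g)}.
    by apply: differentiable_continuous; apply/derivable1_diffP.
  have gl : derive1 g x @[x --> a^'-] --> derive1 g a by exact: cvg_at_left_filter.
  have gr : derive1 g x @[x --> a^'+] --> derive1 g a by exact: cvg_at_right_filter.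
  have [A [B gE]] := local_form_of_jump e0 (cg a) ode_a gl gr.
  have lf : locally_homsol a (fun x => homsol A B x + \sum_i - d i * hump (X i) x).
    apply: locally_homsolD; first by exists A, B; apply: near_all.
    apply: locally_homsol_sum => i _; apply: hump_homsol.
    by apply/eqP => Xa; apply: (notX i).
  have [A' [B' lfE]] := lf; exists A', B'.
  apply: filterS2 gE lfE => x -> <-; rewrite subrr mul0r addr0 -sumrN.
  by congr (_ + _); apply: eq_bigr => i _; rewrite mulNr.
by exists A, B => x; rewrite -gE subrK.
Qed.

Lemma hump_jump_solution A B :
  jump_solution (fun x => homsol A B x + \sum_i d i * hump (X i) x).
Proof.
set g := fun x => _; split.
- move=> x; apply: cvgD; first exact: continuous_homsol.
  suff : continuous (fun x => \sum_i d i * hump (X i) x) by apply.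
  apply: (sum_closed (Q := fun g : R -> R => continuous g)).
  - by move=> y; apply: cvg_cst.
  - by move=> g1 g2 cg1 cg2 y; apply: cvgD; [exact: cg1|exact: cg2].
  - by move=> i _ y; apply: cvgMl_tmp; exact: continuous_hump.
- move=> x xX.
  have [A' [B' gE]] : locally_homsol x g; last exact: locally_homsol_ode gE.
  apply: locally_homsolD; first by exists A, B; apply: near_all.
  apply: locally_homsol_sum => i _; apply/locally_homsolZ/locally_homsol_hump.
  by apply/eqP.
move=> i0; set a := X i0.
have [A' [B' fE]] : locally_homsol a
    (fun x => homsol A B x + \sum_(i | i != i0) d i * hump (X i) x).
  apply: locally_homsolD; first by exists A, B; apply: near_all.
  apply: locally_homsol_sum => i ii0; apply/locally_homsolZ/locally_homsol_hump.
  by rewrite (inj_eq X_inj) eq_sym.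
pose Ad := A' + d i0 * expR (- (a / 2)); pose Bd := B' - d i0 * expR (a / 2).
have gE : \forall x \near a, g x = homsol A' B' x + d i0 * hump a x.
  by apply: filterS fE => x <-; rewrite /g (bigD1 i0) //= addrA [RHS]addrAC.
move: gE => /nbhs_ballP[e /= e0 eP].
have {}eP x : a - e < x < a + e -> g x = homsol A' B' x + d i0 * hump a x.
  by move=> xa; apply: eP; rewrite /ball /= ltr_distlC.
have gR x : a < x < a + e -> g x = homsol A' B' x.
  move=> xa; rewrite eP; last by lra.
  by rewrite hump_right ?mulr0 ?addr0 // ltW //; case/andP: xa.
have gL x : a - e < x < a -> g x = homsol Ad Bd x.
  move=> xa; rewrite eP; last by lra.
  rewrite hump_left; last by lra.
  by rewrite homsol_scale homsol_add mulrN.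
exists (homsol (Ad / 2) (- Bd / 2) a), (homsol (A' / 2) (- B' / 2) a); split.
- have : homsol (Ad / 2) (- Bd / 2) x @[x --> a^'-] --> homsol (Ad / 2) (- Bd / 2) a.
    exact/cvg_at_left_filter/continuous_homsol.
  apply: cvg_trans; apply: near_eq_cvg; near=> x.
  have xa : a - e < x < a.
    apply/andP; split; near: x; last exact: nbhs_left_lt.
    by apply: nbhs_left_gt; rewrite gtrBl.
  rewrite -derive1_homsol !derive1E; apply: near_eq_derive.
  by apply: near_in_oo xa _ => y ya; rewrite gL.
- have : homsol (A' / 2) (- B' / 2) x @[x --> a^'+] --> homsol (A' / 2) (- B' / 2) a.
    exact/cvg_at_right_filter/continuous_homsol.
  apply: cvg_trans; apply: near_eq_cvg; near=> x.
  have xa : a < x < a + e.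
    apply/andP; split; near: x; first exact: nbhs_right_gt.
    by apply: nbhs_right_lt; rewrite ltrDl.
  rewrite -derive1_homsol !derive1E; apply: near_eq_derive.
  by apply: near_in_oo xa _ => y ya; rewrite gR.
have ee : expR (a / 2) * expR (- (a / 2)) = 1 by rewrite -expRD subrr expR0.
rewrite /homsol /Ad /Bd; move: (expR (a / 2)) (expR (- (a / 2))) ee => p q pq.
transitivity (A' / 2 * p + - B' / 2 * q + d i0 * (p * q)); first by field.
by rewrite pq mulr1.
Unshelve. all: by end_near. Qed.
End JumpSolution.
End Global.

(** * Green function and bounded solutions *)

Section Green.
Variable R : realType.
Implicit Types (A B a x M : R).

Lemma homsol_eq_pinfty A B A' B' :
  (\forall x \near +oo, homsol A B x = homsol A' B' x) -> A = A' /\ B = B'.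
Proof.
move=> [x0 [_ h]].
have key x : x0 < x -> (A - A') * expR x = B' - B.
  move=> /h; rewrite /homsol => e.
  have ee : expR (x / 2) * expR (- (x / 2)) = 1 by rewrite -expRD subrr expR0.
  have -> : expR x = expR (x / 2) * expR (x / 2) by rewrite -expRD -splitr.
  move: (expR (x / 2)) (expR (- (x / 2))) e ee => p q e pq.
  have -> : (A - A') * (p * p) = ((A - A') * p) * p by ring.
  have -> : (A - A') * p = (B' - B) * q by lra.
  by rewrite -mulrA (mulrC q) pq mulr1.
have k1 := key (x0 + 1); have k2 := key (x0 + 2).
have AA : A = A'.
  apply/eqP; rewrite -subr_eq0; apply/eqP.
  have : (A - A') * (expR (x0 + 2) - expR (x0 + 1)) = 0.
    by rewrite mulrBr k1 ?k2 ?subrr // ltrDl.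
  move/eqP; rewrite mulf_eq0 (subr_eq0 (expR _)) => /orP[/eqP//|/eqP/expR_inj].
  by lra.
split=> //; have := k1; rewrite AA subrr mul0r => /(_ _)/esym/eqP.
by rewrite subr_eq0 ltrDl ltr01 => /(_ isT)/eqP ->.
Qed.

Lemma homsol_bounded A B M : (\forall x \near +oo, `|homsol A B x| <= M) -> A = 0.
Proof.
move=> [x0 [_ h]]; apply/eqP; apply: contraT => A0.
have normA : 0 < `|A| by rewrite normr_gt0.
pose x := Num.max (x0 + 1) (Num.max 0 (2 * ((M + `|B|) / `|A|))).
have x0x : x0 < x by rewrite lt_max ltrDl ltr01.
have xge0 : 0 <= x by rewrite !le_max lexx orbT.
have xge : (M + `|B|) / `|A| <= x / 2.
  by rewrite ler_pdivlMr // mulrC !le_max lexx !orbT.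
have := h _ x0x; rewrite leNgt => /negP[].
have e1 : 1 + x / 2 <= expR (x / 2) by apply: expR_ge1Dx.
have e2 : expR (- (x / 2)) <= 1 by rewrite expR_le1; lra.
have e3 : M + `|B| < `|A| * expR (x / 2).
  rewrite -ltr_pdivrMl // mulrC (le_lt_trans xge) //; lra.
have e4 : `|B * expR (- (x / 2))| <= `|B|.
  by rewrite normrM (ger0_norm (expR_ge0 _)) ler_piMr.
have e5 : `|A * expR (x / 2)| = `|A| * expR (x / 2).
  by rewrite normrM (ger0_norm (expR_ge0 _)).
have := lerB_normD (A * expR (x / 2)) (B * expR (- (x / 2))).
by rewrite /homsol e5; lra.
Qed.

Lemma homsol_opp A B x : homsol A B (- x) = homsol B A x.
Proof. by rewrite /homsol mulNr opprK addrC. Qed.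

Definition green x a : R := expR (- (`|x - a| / 2)).

Lemma greenE x a : green x a = hump a x + expR (a / 2) * expR (- (x / 2)).
Proof.
rewrite /green /hump -expRD; case: ifP => [xa|/negbT].
  rewrite ltr0_norm ?subr_lt0 //.
  rewrite (_ : a / 2 + - (x / 2) = (a - x) / 2); last by ring.
  by rewrite subrK; congr expR; ring.
rewrite -leNgt => ax; rewrite ger0_norm ?subr_ge0 // add0r.
by congr expR; ring.
Qed.

Variables (n : nat) (X w : 'I_n -> R).
Hypothesis X_lt : forall i j : 'I_n, (i < j)%N -> X i < X j.

Lemma increasing_inj : injective X.
Proof.
move=> i j ij; apply/val_inj.
by case: (ltngtP i j) => // /X_lt; rewrite ij ltxx.
Qed.

(** The humps vanish to the right of their peaks, so the system is strictly
triangular from right to left. *)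
Lemma hump_unique (D : 'I_n -> R) :
  (forall j, D j = \sum_k w k * D k * hump (X k) (X j)) -> forall j, D j = 0.
Proof.
move=> DE j.
have [m] := ubnP (n - j)%N; elim: m j => // m IH j jm.
rewrite DE big1 // => k _; have [jk|kj] := ltnP j k.
  rewrite IH ?mulr0 ?mul0r //.
  by rewrite (leq_trans _ (jm : (n - j <= m)%N)) // ltn_sub2l.
rewrite hump_right ?mulr0 //.
by move: kj; rewrite leq_eqVlt => /orP[/eqP/val_inj->//|/X_lt/ltW].
Qed.

Lemma pinfty_right : \forall x \near +oo, forall k, X k <= x.
Proof.
apply: (@filter_forall R _ (fun k x => X k <= x) +oo) => k.
exact: nbhs_pinfty_ge (num_real _).
Qed.

Lemma hump_sum_right (d : 'I_n -> R) x : (forall k, X k <= x) ->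
  \sum_k d k * hump (X k) x = 0.
Proof. by move=> Xx; rewrite big1 // => k _; rewrite hump_right ?mulr0. Qed.

(** The coefficient of exp (- x / 2) near +oo in the superposition of Green
functions with weights w k * y k. *)
Definition decay_coef (y : 'I_n -> R) : R := \sum_k w k * y k * expR (X k / 2).

Lemma green_sum (y : 'I_n -> R) x : \sum_k w k * y k * green x (X k) =
  homsol 0 (decay_coef y) x + \sum_k w k * y k * hump (X k) x.
Proof.
rewrite /homsol mul0r add0r mulr_suml -big_split /=; apply: eq_bigr => k _.
by rewrite greenE; ring.
Qed.

Definition green_fixed (y : 'I_n -> R) :=
  forall j, y j = \sum_k w k * y k * green (X j) (X k).

(** The combination of y and y' that cancels the leading coefficient at +oo is a
solution vanishing there, hence zero: eigenvalues are simple. *)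
Lemma green_fixed_proportional (y y' : 'I_n -> R) : green_fixed y ->
  green_fixed y' -> forall j, decay_coef y' * y j = decay_coef y * y' j.
Proof.
move=> yE y'E j; apply/eqP; rewrite -subr_eq0; apply/eqP; move: j.
apply: hump_unique => j; rewrite {1}yE {1}y'E !green_sum.
rewrite /homsol !mul0r !add0r !mulrDr !mulrA (mulrC (decay_coef y)) opprD addrACA.
rewrite subrr add0r !mulr_sumr -sumrB; apply: eq_bigr => k _; ring.
Qed.

Lemma decay_coef_eq0 (y : 'I_n -> R) : green_fixed y -> decay_coef y = 0 ->
  forall j, y j = 0.
Proof.
move=> yE y0; apply: hump_unique => j.
by rewrite {1}yE green_sum y0 /homsol !mul0r !add0r.
Qed.

(** In the normal form of g, boundedness near +oo kills the coefficient of
exp (x / 2), and boundedness near -oo fixes the coefficient of exp (- x / 2) to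
the one that turns the humps into Green functions. *)
Lemma bounded_green g M : jump_solution X (fun k => w k * g (X k)) g ->
  (forall x, `|g x| <= M) -> forall x, g x = \sum_k w k * g (X k) * green x (X k).
Proof.
move=> /(jump_solution_hump increasing_inj)[A [B gE]] gM.
pose d k := w k * g (X k).
have A0 : A = 0.
  apply: (@homsol_bounded A B M).
  near=> x; have := gM x; rewrite gE hump_sum_right ?addr0 //.
  by near: x; apply: pinfty_right.
(* Near -oo every hump is homogeneous; reflecting x exchanges the two
   exponentials and reduces to the behaviour near +oo. *)
have B0 : B - \sum_k d k * expR (X k / 2) = 0.
  apply: (@homsol_bounded _ (A + \sum_k d k * expR (- (X k / 2))) M).
  near=> x.
  have Xx : forall k, - X k <= x.
    near: x; apply: (@filter_forall R _ (fun k x => - X k <= x) +oo) => k.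
    exact: nbhs_pinfty_ge (num_real _).
  have := gM (- x); congr (`|_| <= _).
  rewrite gE -[RHS]homsol_opp -[in RHS]homsol_add; congr (_ + _).
  rewrite /homsol mulr_suml -sumrN mulr_suml -big_split /=; apply: eq_bigr => k _.
  rewrite hump_left; last by rewrite lerNl.
  by rewrite /homsol /d; ring.
move=> x; rewrite [RHS](green_sum (fun k => g (X k))) gE A0; congr (homsol _ _ _ + _).
by apply/eqP; rewrite -subr_eq0; apply/eqP.
Unshelve. all: by end_near. Qed.

Lemma green_jump_solution (y : 'I_n -> R) : green_fixed y ->
  let g x := \sum_k w k * y k * green x (X k) in
  jump_solution X (fun k => w k * g (X k)) g.
Proof.
move=> yE g.
have gX k : g (X k) = y k by rewrite yE.
have gE : g = fun x => homsol 0 (decay_coef y) x + \sum_k w k * y k * hump (X k) x.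
  by apply/funext => x; apply: green_sum.
have -> : (fun k => w k * g (X k)) = (fun k => w k * y k).
  by apply/funext => k; rewrite gX.
rewrite gE; exact: hump_jump_solution increasing_inj _ _.
Qed.
End Green.

(** * Solutions of the spectral problem at a real parameter *)

Section Link.
Variables (R : realType) (c : coefficients R) (l : R).
Local Notation n := (npeaks c).

Definition mass (k : 'I_n) : R := l * strength c k + l ^+ 2 * energy c k.

Lemma complex_quarter : (4^-1 : R[i]) = (4^-1 : R)%:C%C.
Proof. by rewrite fmorphV rmorph_nat. Qed.

(** At a real parameter the equation has real coefficients, so the real and the
imaginary part solve it separately. *)
Lemma is_solution_parts (f : R -> R[i]) : is_solution c l%:C%C f ->
  jump_solution (pos c) (fun k => mass k * complex.Re (f (pos c k)))
    (fun x => complex.Re (f x)) /\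
  jump_solution (pos c) (fun k => mass k * complex.Im (f (pos c k)))
    (fun x => complex.Im (f x)).
Proof.
move=> [cf ode jump]; split; split.
- by move=> x; have [] := cf x.
- move=> x /ode[[d1 _] [d2 _] eqf]; split; [exact: d1|exact: d2|].
  move: eqf; rewrite complex_quarter => /(congr1 (@complex.Re R)).
  case: (f x) => a b; rewrite /cderive /= mul0r subr0 => /eqP.
  by rewrite addrC subr_eq0 => /eqP ->.
- move=> i; have [dl [dr [[gl _] [gr _] dlE]]] := jump i.
  exists (complex.Re dl), (complex.Re dr); split; [exact: gl|exact: gr|].
  rewrite dlE /mass -rmorphXn /=; case: (f _) => a b; case: (dr) => u v /=; ring.
- by move=> x; have [] := cf x.
- move=> x /ode[[_ d1] [_ d2] eqf]; split; [exact: d1|exact: d2|].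
  move: eqf; rewrite complex_quarter => /(congr1 (@complex.Im R)).
  case: (f x) => a b; rewrite /cderive /= mul0r addr0 => /eqP.
  by rewrite addrC subr_eq0 => /eqP ->.
- move=> i; have [dl [dr [[_ gl] [_ gr] dlE]]] := jump i.
  exists (complex.Im dl), (complex.Im dr); split; [exact: gl|exact: gr|].
  rewrite dlE /mass -rmorphXn /=; case: (f _) => a b; case: (dr) => u v /=; ring.
Qed.

Lemma is_solution_real (g : R -> R) :
  jump_solution (pos c) (fun k => mass k * g (pos c k)) g ->
  is_solution c l%:C%C (fun x => (g x)%:C%C).
Proof.
move=> [cg ode jump]; split.
- move=> x; split; first exact: cg.
  exact: cvg_cst.
- have d0 : derive1 (fun=> 0 : R) = (fun=> 0 : R).
    by apply/funext => y; rewrite derive1_cst.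
  move=> x /ode[d1 d2 eqg]; split.
  + split; first exact: d1.
    exact: derivable_cst.
  + split; first exact: d2.
    rewrite /= d0; exact: derivable_cst.
  rewrite complex_quarter /cderive /= d0 derive1_cst -complexr0 /= eqg.
  by apply/eqP; rewrite eq_complex; apply/andP; split; apply/eqP => /=; ring.
- move=> i; have [dl [dr [gl gr dlr]]] := jump i.
  have d0 : derive1 (fun=> 0 : R) = (fun=> 0 : R).
    by apply/funext => y; rewrite derive1_cst.
  exists dl%:C%C, dr%:C%C; split.
  + split; first exact: gl.
    rewrite /cderive /= d0; exact: cvg_cst.
  + split; first exact: gr.
    rewrite /cderive /= d0; exact: cvg_cst.
  by rewrite dlr /mass -rmorphXn -!rmorphM -!rmorphD mulrDl addrA.
Qed.
End Link.

(** * Eigenfunctions and the solution phi_+ *)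

Section Eigen.
Variables (R : realType) (c : coefficients R) (l : R).
Local Notation n := (npeaks c).
Local Notation X := (pos c).
Local Notation w := (mass (c := c) l).

Lemma eigenvalue_of_green_fixed (y : 'I_n -> R) : green_fixed X w y ->
  (exists k, y k != 0) -> is_eigenvalue c l%:C%C.
Proof.
move=> yE [k0 yk0]; pose g x := \sum_k w k * y k * green x (X k).
exists (fun x => (g x)%:C%C); split.
- exact/is_solution_real/green_jump_solution/yE/pos_increasing.
- by exists (X k0); rewrite /g -yE => /complexI yk; rewrite yk eqxx in yk0.
exists (\sum_k `|w k * y k|) => x.
rewrite /cabs normc_def /= expr0n /= addr0 sqrtr_sqr.
apply: le_trans (ler_norm_sum _ _ _) _; apply: ler_sum => k _.
rewrite normrM ler_piMr // ger0_norm ?expR_ge0 // expR_le1 oppr_le0.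
by rewrite divr_ge0.
Qed.

(** The real or the imaginary part of a bounded nontrivial solution, divided by
its nonzero coefficient of exp (- x / 2) near +oo, is a function phi equal to
exp (- x / 2) near +oo.  Any other such solution p agrees with it: the normal
forms of p and phi have the same homogeneous part, so the values of
p - phi at the peaks vanish by hump_unique. *)
Lemma phi_plus_green : is_eigenvalue c l%:C%C -> exists y : 'I_n -> R,
  [/\ exists k, y k != 0, green_fixed X w y &
   forall x, phi_plus c l%:C%C x = (\sum_k w k * y k * green x (X k))%:C%C].
Proof.
move=> [f [fsol [x0 fx0] [M fM]]].
have [solRe solIm] := is_solution_parts fsol.
have cabs_ge (z : R[i]%C) : `|complex.Re z| <= cabs z /\ `|complex.Im z| <= cabs z.
  case: z => a b; rewrite /cabs normc_def /= -!sqrtr_sqr.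
  by split; rewrite ler_wsqrtr // ?lerDl ?lerDr sqr_ge0.
have X_lt := pos_increasing (c := c).
have [g [gsol gM [x1 gx1]]] : exists g, [/\
    jump_solution X (fun k => w k * g (X k)) g,
    forall x, `|g x| <= M & exists x, g x != 0].
  have [Re0|Re0] := eqVneq (complex.Re (f x0)) 0.
    exists (fun x => complex.Im (f x)); split=> //.
      by move=> x; have [_ h] := cabs_ge (f x); apply: le_trans h (fM x).
    exists x0; apply/eqP => Im0; apply: fx0.
    by move: Re0 Im0; case: (f x0) => a b /= -> ->.
  exists (fun x => complex.Re (f x)); split=> //; last by exists x0.
  by move=> x; have [h _] := cabs_ge (f x); apply: le_trans h (fM x).
have gE := bounded_green X_lt gsol gM.
have gfix : green_fixed X w (fun k => g (X k)) by move=> j; apply: gE.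
set b := decay_coef X w (fun k => g (X k)).
have b0 : b != 0.
  apply: contraNneq gx1 => /(decay_coef_eq0 X_lt gfix) g0.
  by rewrite gE big1 // => k _; rewrite g0 mulr0 mul0r.
pose y k := b^-1 * g (X k).
have yfix : green_fixed X w y.
  move=> j; rewrite /y gfix mulr_sumr; apply: eq_bigr => k _; ring.
pose phi x := \sum_k w k * y k * green x (X k).
have phiX k : phi (X k) = y k by rewrite yfix.
have decay1 : decay_coef X w y = 1.
  rewrite -(mulVf b0) [in RHS]/b /decay_coef mulr_sumr; apply: eq_bigr => k _.
  by rewrite /y; ring.
have phiE x : phi x = homsol 0 1 x + \sum_k w k * y k * hump (X k) x.
  by rewrite -decay1; apply: green_sum.
exists y; split=> //.
  apply: contrapT => y0; move/eqP: (b0); apply; rewrite /b /decay_coef big1 // => k _.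
  have [->|gk] := eqVneq (g (X k)) 0; first by rewrite mulr0 mul0r.
  by case: y0; exists k; exact: mulf_neq0 (invr_neq0 b0) gk.
have : is_phi_plus c l%:C%C (phi_plus c l%:C%C).
  apply: (@xgetPex _ (fun=> 0) [set f | is_phi_plus c l%:C%C f]).
  exists (fun x => (phi x)%:C%C); split.
    exact/is_solution_real/green_jump_solution/yfix.
  near=> x; congr (_%:C%C); rewrite phiE hump_sum_right.
    by rewrite /homsol mul0r add0r mul1r addr0.
  by near: x; apply: pinfty_right.
set p := phi_plus c _ => -[psol pE].
have [pRe pIm] := is_solution_parts psol.
have Xinj := increasing_inj X_lt.
have [A [B reE]] := jump_solution_hump Xinj pRe.
have [A' [B' imE]] := jump_solution_hump Xinj pIm.
have [A0 B1] : A = 0 /\ B = 1.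
  apply: homsol_eq_pinfty; near=> x.
  have -> : homsol A B x = complex.Re (p x).
    by rewrite reE hump_sum_right ?addr0 //; near: x; apply: pinfty_right.
  have -> : p x = (expR (- (x / 2)))%:C%C by near: x.
  by rewrite /homsol mul0r add0r mul1r.
have [A0' B0'] : A' = 0 /\ B' = 0.
  apply: homsol_eq_pinfty; near=> x.
  have -> : homsol A' B' x = complex.Im (p x).
    by rewrite imE hump_sum_right ?addr0 //; near: x; apply: pinfty_right.
  have -> : p x = (expR (- (x / 2)))%:C%C by near: x.
  by rewrite /homsol !mul0r addr0.
have im0 k : complex.Im (p (X k)) = 0.
  move: k; apply: (hump_unique (w := w) X_lt) => j.
  by rewrite imE A0' B0' /homsol !mul0r !add0r.
have re0 k : complex.Re (p (X k)) - y k = 0.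
  move: k; apply: (hump_unique (w := w) X_lt) => j.
  rewrite reE -phiX phiE A0 B1 opprD addrACA subrr add0r -sumrB.
  by apply: eq_bigr => k _; ring.
move=> x; apply/eqP; rewrite eq_complex /= reE imE A0 B1 A0' B0'.
rewrite andbC [X in X == 0](_ : _ = 0) ?eqxx /=; last first.
  rewrite /homsol !mul0r !add0r big1 // => k _.
  by rewrite im0 mulr0 mul0r.
apply/eqP; rewrite -/(phi x) phiE; congr (_ + _).
by apply: eq_bigr => k _; have /eqP := re0 k; rewrite subr_eq0 => /eqP ->.
Unshelve. all: by end_near. Qed.
End Eigen.

(** * Trace formula for the spectral problem *)

Section TraceFormula.
Variables (R : realType) (c : coefficients R) (N : nat) (l : 'I_N -> R).
Hypothesis l_spectrum : is_spectrum c l.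
Local Notation n := (npeaks c).
Local Notation X := (pos c).

Lemma cabs_real (r : R) : cabs r%:C%C = `|r|.
Proof. by rewrite /cabs normc_def /= expr0n /= addr0 sqrtr_sqr. Qed.

Lemma trace_formula x :
  \sum_k strength c k * expR (- `|x - X k|) =
    \sum_i cabs (normalized_eigenfunction c (l i) x) ^+ 2 / l i.
Proof.
have [l_incr l_eig] := l_spectrum.
have X_lt := pos_increasing (c := c).
have eig i : is_eigenvalue c (l i)%:C%C by apply/l_eig; exists i.
have [Y YP] := choice (fun i => phi_plus_green (eig i)).
have l0 i : l i != 0.
  have [[k yk] yE _] := YP i; apply: contraNneq yk => li0.
  by rewrite yE big1 // => j _; rewrite /mass li0 expr0n /= !mul0r addr0 !mul0r.
have [L Lunit LE] := kernel_factor X_lt.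
pose om : 'rV[R]_n := \row_k strength c k.
pose v : 'rV[R]_n := \row_k energy c k.
pose row_of (y : 'I_n -> R) : 'rV[R]_n := \row_k y k.
have weightE b (y : 'rV[R]_n) (q : 'rV[R]_n) :
    dotr (y *m weight om v b) q = \sum_k mass (c := c) b k * y 0 k * q 0 k.
  rewrite /dotr mxE; apply: eq_bigr => k _.
  by rewrite mul_mx_diag !mxE /mass; ring.
have fixedE b (y : 'rV[R]_n) : (y *m weight om v b *m (L *m L^T) = y) <->
    green_fixed X (mass (c := c) b) (fun k => y 0 k).
  have coord j : (y *m weight om v b *m (L *m L^T)) 0 j =
      \sum_k mass (c := c) b k * y 0 k * green (X j) (X k).
    rewrite LE mxE; apply: eq_bigr => k _.
    by rewrite mul_mx_diag !mxE /mass /green distrC; ring.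
  split=> [yE j|yE]; first by rewrite -[in LHS]yE coord.
  by apply/rowP => j; rewrite coord -yE.
have v_ge0 k : 0 <= v 0 k by rewrite mxE energy_ge0.
pose y i := row_of (Y i).
(* The square of green is the kernel of the profile, so q Omega q^T is the
   left-hand side of the trace formula. *)
pose q := row_of (fun k => green x (X k)).
have y0 i : y i != 0.
  have [[k yk] _ _] := YP i; apply: contraNneq yk => yi0.
  by have /rowP/(_ k) := yi0; rewrite !mxE => ->.
have Yrow i : (fun k => y i 0 k) = Y i by apply/funext => k; rewrite mxE.
have yfix i : y i *m weight om v (l i) *m (L *m L^T) = y i.
  by apply/fixedE; rewrite Yrow; have [] := YP i.
have l_inj : injective l.
  move=> i j lij; apply/val_inj.
  by case: (ltngtP i j) => // /l_incr; rewrite lij ltxx.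
have complete b w : b != 0 -> w != 0 -> w *m weight om v b *m (L *m L^T) = w ->
    exists i k, b = l i /\ w = k *: y i.
  move=> b0 w0 /fixedE wfix.
  have wk : exists k, w 0 k != 0.
    apply: contrapT => wk; case/eqP: w0; apply/rowP => k; rewrite mxE.
    by apply/eqP; apply: contrapT => /negP wk0; case: wk; exists k.
  have [i /complexI bl] := (l_eig _).1 (eigenvalue_of_green_fixed wfix wk).
  subst b; have [[k yk] yE _] := YP i.
  exists i; set w' := fun k => w 0 k in wfix.
  exists (decay_coef X (mass (c := c) (l i)) w' / decay_coef X (mass (c := c) (l i)) (Y i)).
  split=> //; apply/rowP => j; rewrite !mxE.
  have d0 : decay_coef X (mass (c := c) (l i)) (Y i) != 0.
    by apply: contraNneq yk => /(decay_coef_eq0 X_lt yE) ->.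
  have := green_fixed_proportional X_lt wfix yE j; rewrite /w' => e.
  by apply: (mulfI d0); rewrite e mulrA mulrCA mulfV // mulr1.
have [] := pencil_trace v_ge0 Lunit q l_inj l0 y0 yfix complete.
pose gam i := dotr (y i *m diag_mx om) (y i)
  + 2 * l i * dotr (y i *m diag_mx v) (y i).
move=> gam_gt0 trace.
have phiX i k : phi_plus c (l i)%:C%C (X k) = (Y i k)%:C%C.
  by have [_ yE phiE] := YP i; rewrite phiE -yE.
have gamE i : gamma2 c (l i) = gam i.
  rewrite /gamma2 /gam /dotr !mxE; congr (_ + _ * _); apply: eq_bigr => k _.
    by rewrite phiX cabs_real real_normK ?num_real // mul_mx_diag !mxE; ring.
  by rewrite phiX cabs_real real_normK ?num_real // mul_mx_diag !mxE; ring.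
transitivity (dotr (q *m diag_mx om) q).
  rewrite /dotr mxE; apply: eq_bigr => k _; rewrite mul_mx_diag !mxE.
  rewrite /green [LHS]mulrC mulrAC -expRD; congr (expR _ * _); lra.
rewrite trace; apply: eq_bigr => i _; rewrite -/(gam i); congr (_ / _).
have [_ _ phiE] := YP i.
rewrite /normalized_eigenfunction phiE -fmorphV -rmorphM cabs_real.
rewrite real_normK ?num_real // exprMn exprVn gamE sqr_sqrtr ?ltW //.
congr (_ ^+ 2 / _); rewrite weightE; apply: eq_bigr => k _.
by rewrite !mxE.
Qed.
End TraceFormula.

Theorem theorem5p1 (R : realType) (u : R -> R -> R)
    (mu : R -> {measure set (measurableTypeR R) -> \bar R})
    (c : R -> coefficients R)
    (hu : global_conservative_multipeakon u mu c)
    (N : nat) (lambda : 'I_N -> R) (t : R)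
    (hlambda : is_spectrum (c t) lambda) (x : R) :
  u x t = 2^-1 * \sum_(i < N)
    cabs (normalized_eigenfunction (c t) (lambda i) x) ^+ 2 / lambda i.
Proof. by rewrite (multipeakon_profile hu) (trace_formula hlambda). Qed.
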